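(* Let $F(\mathbf u)=\sum_{i=1}^m g_i(\langle \mathbf u,\mathbf e_i\rangle)$ be an orthogonally decomposable (odeco) function on the closed unit ball of $\mathbb R^d$. Then the set $\{\pm \mathbf e_i : i\in\{1,\dots,m\}\}$ is a complete enumeration of the local maxima of $|F|$ with respect to the domain $S^{d-1}=\{\mathbf u\in\mathbb R^d:\|\mathbf u\|=1\}$; that is, a point $\mathbf v\in S^{d-1}$ is a local maximum of the restriction of $|F|$ to $S^{d-1}$ if and only if $\mathbf v\in\{\pm\mathbf e_1,\dots,\pm\mathbf e_m\}$.
   Context: Let $d\ge 2$, $1\le m\le d$, and let $\mathbf e_1,\dots,\mathbf e_m$ be orthonormal vectors in $\mathbb R^d$. An odeco function is a function $F:\overline{B(0,1)}\to\mathbb R$ of the form $F(\mathbf u)=\sum_{i=1}^m g_i(\langle\mathbf u,\mathbf e_i\rangle)$, where each $g_i\in C^2([-1,1])$ is real valued and satisfies: (1) $g_i$ is either an even function or an odd function; (2) either $\frac{d^2}{dx^2}g_i(\sqrt x)>0$ for all $x\in(0,1]$, or $-\frac{d^2}{dx^2}g_i(\sqrt x)>0$ for all $x\in(0,1]$; (3) the right derivative at the origin satisfies $\frac{d}{dx}g_i(\sqrt x)|_{x=0^+}=0$; (4) $g_i(0)=0$. *)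

(* Defs.v *)
From mathcomp Require Export all_boot all_order all_algebra.
From mathcomp Require Export all_classical all_reals all_analysis.
Export Order.TTheory GRing.Theory Num.Theory.
Export numFieldNormedType.Exports.

Set Implicit Arguments.
Unset Strict Implicit.
Unset Printing Implicit Defensive.

Local Open Scope classical_set_scope.
Local Open Scope ring_scope.

Section DerivativeWithin.
Variable R : realType.

(* Derivative relative to A: two-sided at interior points of A, one-sided at the
   endpoints when A is an interval. Only the values of f on A matter at points
   of A. *)
Definition diff_quotient_within (A : set R) (f : R -> R) (x : R) :=
  (f y - f x) / (y - x) @[y --> within A x^'].

Definition derivable_within (A : set R) (f : R -> R) (x : R) : Prop :=
  cvg (diff_quotient_within A f x).

Definition derive_within (A : set R) (f : R -> R) (x : R) : R :=
  lim (diff_quotient_within A f x).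

Definition derive2_within (A : set R) (f : R -> R) : R -> R :=
  derive_within A (derive_within A f).

Definition C2_within (A : set R) (f : R -> R) : Prop :=
  [/\ {in A, forall x, derivable_within A f x},
      {in A, forall x, derivable_within A (derive_within A f) x}
    & {within A, continuous (derive2_within A f)}].

End DerivativeWithin.

(* 'rV[R]_d carries the sup norm in the library; its topology is the Euclidean
   one, but the Euclidean inner product and norm have to be introduced. *)
Section Euclidean.
Variables (R : realType) (d : nat).

Definition inner (u v : 'rV[R]_d) : R := \sum_k u ord0 k * v ord0 k.

Definition enorm (u : 'rV[R]_d) : R := Num.sqrt (inner u u).

Definition eball : set 'rV[R]_d := [set u | enorm u <= 1].

Definition esphere : set 'rV[R]_d := [set u | enorm u = 1].

Definition orthonormal_family (m : nat) (e : 'I_m -> 'rV[R]_d) : Prop :=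
  forall i j, inner (e i) (e j) = (i == j)%:R.

End Euclidean.

Definition local_max_on (R : realType) (T : topologicalType) (A : set T)
    (f : T -> R) (v : T) : Prop :=
  A v /\ \forall u \near within A (nbhs v), f u <= f v.

Section Odeco.
Variable R : realType.

(* g represents a function [-1,1] -> R; its values elsewhere play no role. *)
Record odeco_contribution (g : R -> R) : Prop := OdecoContribution {
  contribution_C2 : C2_within `[-1, 1] g;
  contribution_parity :
    {in `[-1, 1], forall x, g (- x) = g x} \/
    {in `[-1, 1], forall x, g (- x) = - g x};
  contribution_convexity :
    let h x := g (Num.sqrt x) in
    {in `]0, 1], forall x, 0 < derive2_within `[0, 1] h x} \/
    {in `]0, 1], forall x, 0 < - derive2_within `[0, 1] h x};
  contribution_right_derivative :
    let h x := g (Num.sqrt x) in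
    derivable_within `[0, 1] h 0 /\ derive_within `[0, 1] h 0 = 0;
  contribution_zero : g 0 = 0
}.

(* F represents a function on the closed unit ball; its values elsewhere play no
   role. *)
Definition odeco_decomposition (d m : nat) (e : 'I_m -> 'rV[R]_d)
    (g : 'I_m -> R -> R) (F : 'rV[R]_d -> R) : Prop :=
  [/\ orthonormal_family e,
      forall i, odeco_contribution (g i)
    & forall u, eball u -> F u = \sum_i g i (inner u (e i))].

End Odeco.

(* Main.v *)
Require Import Defs.
From mathcomp Require Import ring lra.

(* Write |g_i x| = H_i(x^2) on [-1, 1]: H_i is strictly convex and strictly
   increasing with H_i(0) = H_i'(0) = 0. Near +-e_k on the sphere,
   H_j(u_j^2) <= H_k(1) u_j^2 for every j (by convexity if j = k, by H_j'(0) = 0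
   otherwise), so |F u| <= H_k(1) by Bessel's inequality. Conversely, at a local
   maximum v of |F| replace F by -F so that F v = |F v|; then some nonzero
   coordinate v_k contributes +H_k(v_k^2) (if v is orthogonal to the frame, then
   F v = 0, but F takes nonzero values arbitrarily close to v). Moving an amount t of squared norm
   into v_k from another orthogonal component y of v strictly increases F if y
   is orthogonal to the frame or contributes negatively, while if y contributes
   positively F is strictly convex in t; so no such y exists and v = +-e_k. *)

Set Implicit Arguments.
Unset Strict Implicit.
Unset Printing Implicit Defensive.

Local Open Scope classical_set_scope.
Local Open Scope ring_scope.

(** * Calculus of derivatives relative to an interval, and the profile of a contribution *)

Section DerivativeWithin.
Variable R : realType.
Implicit Types (f : R -> R) (A : set R) (x : R).

Lemma derivable_withinP A f x (e : R) : 0 < e -> derivable_within A f x ->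
  exists2 r : R, 0 < r & forall y, A y -> y != x -> `|y - x| < r ->
    `|(f y - f x) / (y - x) - derive_within A f x| <= e.
Proof.
move=> e0 /cvgrPdist_le /(_ _ e0).
rewrite !near_withinE => /nbhs_ballP [r /= r0 Hr].
exists r => // y Ay yx yr; rewrite distrC; apply: Hr => //.
by rewrite /ball /= distrC.
Qed.

(** Near [x] the difference quotient stays within 1 of its limit [D], which gives a Lipschitz bound
    at [x] with constant [|D| + 1]. *)
Lemma derivable_within_continuous A B f : B `<=` A ->
  (forall x, B x -> derivable_within A f x) -> {within B, continuous f}.
Proof.
move=> BA fd; apply/subspace_continuousP => x Bx.
have [r r0 Hr] := derivable_withinP ltr01 (fd _ Bx).
set D := derive_within A f x in Hr.
apply/cvgrPdist_le => e e0.
have D0 : 0 < `|D| + 1 by rewrite ltr_wpDl.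
rewrite near_withinE; apply/nbhs_ballP; exists (Num.min r (e / (`|D| + 1))) => /=.
  by rewrite lt_min r0 divr_gt0.
move=> y; rewrite /ball /= distrC lt_min ltr_pdivlMr // => /andP[yr ye] By.
have [->|yx] := eqVneq y x; first by rewrite subrr normr0 ltW.
have := Hr _ (BA _ By) yx yr => H.
have H2 : `|(f y - f x) / (y - x)| <= `|D| + 1.
  rewrite -[X in `|X| <= _](subrK D) addrC (le_trans (ler_normD _ _)) ?lerD2l //.
change (`|f x - f y| <= e); rewrite distrC -[f y - f x](@divfK _ (y - x)) ?subr_eq0 //.
rewrite normrM (le_trans _ (ltW ye)) // mulrC ler_wpM2l //.
Qed.

(** At an interior point small increments stay inside the interval, so the relative derivative is
    the ordinary one; this gives access to the mean value theorem. *)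
Lemma derivable_within_is_derive (a b : R) f x : a < x < b ->
  derivable_within `[a, b] f x -> is_derive x 1 f (derive_within `[a, b] f x).
Proof.
move=> /andP[ax xb] fd.
have H : h^-1 *: ((f \o shift x) (h *: 1) - f x) @[h --> 0^'] --> derive_within `[a, b] f x.
  apply/cvgrPdist_le => e e0.
  have [r r0 Hr] := derivable_withinP e0 fd.
  rewrite near_withinE; apply/nbhs_ballP.
  exists (Num.min r (Num.min (x - a) (b - x))) => /=; first by rewrite !lt_min r0 !subr_gt0 ax xb.
  move=> h; rewrite /ball /= sub0r normrN !lt_min => /and3P[hr ha hb] h0.
  have e1 : h%:A + x - x = h by rewrite addrK /GRing.scale /= mulr1.
  have := Hr (h%:A + x); rewrite e1 distrC /GRing.scale /= !mulr1 mulrC; apply => //.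
  - move: ha hb; rewrite !ltr_norml /= in_itv /= => ??; lra.
  - by rewrite -subr_eq0 addrK.
apply: DeriveDef; first by apply/cvg_ex; eexists; exact: H.
exact: cvg_lim H.
Qed.

Lemma derive_within_mvt (a b : R) f x y : a <= x -> x < y -> y <= b ->
  (forall z, x < z < y -> derivable_within `[a, b] f z) ->
  {within `[x, y], continuous f} ->
  exists2 z, x < z < y & f y - f x = derive_within `[a, b] f z * (y - x).
Proof.
move=> ax xy yb fd fc.
have fD z : z \in `]x, y[%R -> is_derive z 1 f (derive_within `[a, b] f z).
  rewrite in_itv /= => zxy; apply: derivable_within_is_derive (fd _ zxy).
  by case/andP: zxy => xz zy; rewrite (le_lt_trans ax xz) (lt_le_trans zy yb).
by have [z zxy ->] := MVT xy fD fc; exists z; rewrite in_itv in zxy.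
Qed.

(** The limit of a divergent quotient is by convention the default point 0, so a nonzero value
    certifies convergence. A strict sign of the second derivative thereby yields its existence. *)
Lemma derive_within_neq0 A f x : derive_within A f x != 0 -> derivable_within A f x.
Proof.
by move=> fx; apply: contrapT => fd; rewrite /derive_within (dvgP fd) eqxx in fx.
Qed.

(** Chain rule by hand: since [y - x] is the product of the difference and the sum of the two square
    roots, the quotient factors into a quotient of [f] times the inverse of that sum. *)
Lemma derivable_within_sqrt (f : R -> R) x : 0 < x <= 1 ->
  derivable_within `[-1, 1] f (Num.sqrt x) ->
  derivable_within `[0, 1] (fun y => f (Num.sqrt y)) x.
Proof.
move=> /andP[x0 x1] fd.
set L := derive_within `[-1, 1] f (Num.sqrt x).
apply/cvg_ex; exists (L * (Num.sqrt x + Num.sqrt x)^-1).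
have s0 : 0 < Num.sqrt x by rewrite sqrtr_gt0.
have sc : {for x, continuous (@Num.sqrt R)} by exact: sqrt_continuous.
have H : (f (Num.sqrt y) - f (Num.sqrt x)) / (Num.sqrt y - Num.sqrt x) *
    (Num.sqrt y + Num.sqrt x)^-1 @[y --> within `[0, 1] x^'] -->
    L * (Num.sqrt x + Num.sqrt x)^-1.
  apply: cvgM.
    apply: (@cvg_comp _ _ _ (@Num.sqrt R) (fun s => (f s - f (Num.sqrt x)) / (s - Num.sqrt x))); last exact: fd.
    (* The square root is injective on nonnegative numbers, so it maps punctured neighbourhoods of
       [x] within [0, 1] to punctured ones of its image within [-1, 1]. *)
    move=> P HP; have := sc _ HP; apply: (@filterS _ (nbhs x)) => y {}HP yx y01.
    have y0 : 0 <= y by move: y01; rewrite /= in_itv /= => /andP[].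
    have y1 : y <= 1 by move: y01; rewrite /= in_itv /= => /andP[].
    apply: HP; first by rewrite eqr_sqrt // ltW.
    rewrite /= in_itv /= (le_trans _ (sqrtr_ge0 y)) //= -[leRHS]sqrtr1.
    by rewrite ler_wsqrtr.
  apply: cvgV; first by rewrite gt_eqF ?addr_gt0.
  apply: cvgD; last exact: cvg_cst.
  by do 2 apply: cvg_within_filter; exact: sc.
apply: cvg_trans H; apply: near_eq_cvg; rewrite !near_withinE.
near=> y => yx; rewrite /= in_itv /= => /andP[y0 y1].
rewrite -mulrA -invfM -subr_sqr !sqr_sqrtr // ltW //.
Unshelve. all: by end_near. Qed.

(** [profile_convex] compares the slopes of adjacent chords with denominators cleared;
    [profile_flat] is the upper half of H'(0) = 0, in epsilon form. *)
Record profile (H : R -> R) : Prop := Profile {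
  profile0 : H 0 = 0;
  profile_lt : forall x y, 0 <= x -> x < y -> y <= 1 -> H x < H y;
  profile_convex : forall x y z, 0 <= x -> x < y -> y < z -> z <= 1 ->
    (H y - H x) * (z - y) < (H z - H y) * (y - x);
  profile_flat : forall c, 0 < c ->
    exists2 r, 0 < r & forall x, 0 <= x <= 1 -> x < r -> H x <= c * x }.

(** The sign of the second derivative makes [s * D] strictly increasing on ]0, 1], and flatness at 0
    then makes it positive there. The mean value theorem turns these two facts into strict convexity
    and strict monotonicity. *)
Lemma profile_of_derivatives (h : R -> R) (s : R) : s = 1 \/ s = -1 -> h 0 = 0 ->
  {in `]0, 1], forall x, derivable_within `[0, 1] h x} ->
  {in `]0, 1], forall x, 0 < s * derive2_within `[0, 1] h x} ->
  derivable_within `[0, 1] h 0 -> derive_within `[0, 1] h 0 = 0 ->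
  profile (fun x => s * h x).
Proof.
move=> s1 h0 hd hdd hd0 h00.
have ns : `|s| = 1 by case: s1 => ->; rewrite ?normrN normr1.
set D := derive_within `[0, 1] h in h00 *.
have hd' x : 0 <= x <= 1 -> derivable_within `[0, 1] h x.
  case/andP; rewrite le_eqVlt => /orP[/eqP <- //|x0 x1]; apply: hd.
  by rewrite in_itv /= x0.
have Dlt x y : 0 < x -> x < y -> y <= 1 -> s * D x < s * D y.
  move=> x0 xy y1.
  have Dd z : x <= z <= y -> derivable_within `[0, 1] D z.
    move=> /andP[xz zy].
    have /hdd : z \in `]0, 1] by rewrite in_itv /= (lt_le_trans x0 xz) (le_trans zy).
    move=> H; apply: derive_within_neq0; apply/eqP => H0; move: H.
    by rewrite /derive2_within -/D H0 mulr0 ltxx.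
  have Dc : {within `[x, y], continuous D}.
    apply: (@derivable_within_continuous `[0, 1]).
      move=> z; rewrite /= !in_itv /= => /andP[xz zy].
      by rewrite (le_trans (ltW x0) xz) (le_trans zy).
    by move=> z; rewrite /= in_itv; exact: Dd.
  have [z /andP[xz zy] Dxy] : exists2 z, x < z < y &
      D y - D x = derive_within `[0, 1] D z * (y - x).
    apply: derive_within_mvt => //; first exact: ltW.
    by move=> z /andP[xz zy]; apply: Dd; rewrite !ltW.
  rewrite -subr_gt0 -mulrBr Dxy mulrA mulr_gt0 ?subr_gt0 //.
  by apply: hdd; rewrite in_itv /= (lt_trans x0 xz) (le_trans (ltW zy)).
have mvt x y : 0 <= x -> x < y -> y <= 1 ->
    exists2 z, x < z < y & s * h y - s * h x = s * D z * (y - x).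
  move=> x0 xy y1; have [||z zxy hxy] := @derive_within_mvt 0 1 h x y x0 xy y1.
  - move=> z /andP[xz zy]; apply: hd'.
    by rewrite (le_trans x0 (ltW xz)) (le_trans (ltW zy)).
  - apply: (@derivable_within_continuous `[0, 1]).
      move=> z; rewrite /= !in_itv /= => /andP[xz zy].
      by rewrite (le_trans x0 xz) (le_trans zy).
    move=> z; rewrite /= in_itv => /andP[xz zy]; apply: hd'.
    by rewrite (le_trans x0 xz) (le_trans zy).
  - by exists z; rewrite // -mulrBr hxy mulrA.
have flat c : 0 < c ->
    exists2 r, 0 < r & forall x, 0 <= x <= 1 -> x < r -> `|h x| <= c * x.
  move=> c0; have [r r0 Hr] := derivable_withinP c0 hd0; exists r => // x /andP[x0 x1] xr.
  move: x0; rewrite le_eqVlt => /orP[/eqP <-|x0]; first by rewrite h0 normr0 mulr0.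
  have := Hr x; rewrite -/D h00 h0 !subr0 normrM normfV (gtr0_norm x0) ler_pdivrMr //.
  by apply; rewrite ?gt_eqF // /= in_itv /= ltW.
(* a negative slope at [x] persists to the left of [x], against [h'(0) = 0] *)
have Dgt0 x : 0 < x -> x <= 1 -> 0 < s * D x.
  move=> x0 x1; rewrite ltNge; apply/negP => Dx.
  have y0 : 0 < x / 2 by rewrite divr_gt0.
  have yx : x / 2 < x by lra.
  have Dy := lt_le_trans (Dlt _ _ y0 yx x1) Dx.
  have [r r0 Hr] : exists2 r, 0 < r & forall x0 : R, 0 <= x0 <= 1 -> x0 < r -> `|h x0| <= (- (s * D (x / 2))) * x0.
    by apply: flat; rewrite oppr_gt0.
  (* With [t] below both [r] and [x / 2], the mean slope over [0, [t]] is below [s * D (x / 2)],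
     which contradicts the flatness bound at [t]. *)
  set t := Num.min r (x / 2) / 2.
  have t0 : 0 < t by rewrite divr_gt0 // lt_min r0.
  have [tr tx] : t < r /\ t < x / 2.
    have : 0 < Num.min r (x / 2) by rewrite lt_min r0.
    have : Num.min r (x / 2) <= r by rewrite ge_min lexx.
    have : Num.min r (x / 2) <= x / 2 by rewrite ge_min lexx orbT.
    by rewrite /t; lra.
  have t1 : t <= 1 by lra.
  have [z /andP[z0 zt]] := mvt 0 t (lexx _) t0 t1; rewrite h0 mulr0 !subr0 => ht.
  have := Hr t; rewrite (ltW t0) t1 => /(_ isT tr).
  have -> : `|h t| = `|s * h t| by rewrite normrM ns mul1r.
  have Dz : s * D z < s * D (x / 2) by apply: Dlt; lra.
  rewrite ht normrM (gtr0_norm t0) ler_pM2r // ltr0_norm ?(lt_trans Dz) // lerN2.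
  by rewrite leNgt Dz.
split.
- by rewrite h0 mulr0.
- move=> x y x0 xy y1; have [z /andP[xz zy] hxy] := mvt x y x0 xy y1.
  by rewrite -subr_gt0 hxy mulr_gt0 ?subr_gt0 // Dgt0 ?(le_lt_trans x0 xz) ?(le_trans (ltW zy)).
- move=> x y z x0 xy yz z1.
  have [u /andP[xu uy] ->] := mvt x y x0 xy (le_trans (ltW yz) z1).
  have [w /andP[yw wz] ->] := mvt y z (le_trans x0 (ltW xy)) yz z1.
  rewrite mulrAC ltr_pM2r ?subr_gt0 // ltr_pM2r ?subr_gt0 //.
  by apply: Dlt; lra.
- move=> c c0; have [r r0 Hr] := flat c c0; exists r => // x x01 xr.
  by rewrite (le_trans (ler_norm _)) // normrM ns mul1r Hr.
Qed.

(* On each half-line the sign of [g] is constant: scaling [x] by [c > 0] keeps [s]. *)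
Lemma contribution_profile (g : R -> R) : odeco_contribution g ->
  exists2 H, profile H & forall x, -1 <= x <= 1 ->
   exists2 s, (s = 1 \/ s = -1) &
     forall c, 0 < c -> -1 <= c * x <= 1 -> g (c * x) = s * H ((c * x) ^+ 2).
Proof.
move=> [[gd _ _] gp gc [gd0 gd00] g0].
set h := fun x => g (Num.sqrt x) in gc gd0 gd00.
have [s s1 sc] : exists2 s : R, (s = 1 \/ s = -1) &
    {in `]0, 1], forall x, 0 < s * derive2_within `[0, 1] h x}.
  case: gc => gc; first by exists 1; [left|move=> x /gc; rewrite mul1r].
  by exists (-1); [right|move=> x /gc; rewrite mulN1r].
exists (fun x => s * h x).
  apply: profile_of_derivatives => //; first by rewrite /h sqrtr0.
  move=> x; rewrite in_itv /= => x01; apply: derivable_within_sqrt => //.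
  case/andP: x01 => x0 x1.
  apply: gd; rewrite inE /= in_itv /= (le_trans _ (sqrtr_ge0 x)) //= -[leRHS]sqrtr1.
  by rewrite ler_wsqrtr.
have ss : s * s = 1 by case: s1 => ->; rewrite ?mulrNN mulr1.
have gE y : 0 <= y -> g y = s * (s * h (y ^+ 2)).
  by move=> y0; rewrite mulrA ss mul1r /h sqrtr_sqr ger0_norm.
move=> x x1; case: (leP 0 x) => x0.
  by exists s => // c c0 cx; apply: gE; rewrite mulr_ge0 // ltW.
have nE c : 0 < c -> g (- (c * x)) = s * (s * h ((c * x) ^+ 2)).
  by move=> c0; rewrite gE ?sqrrN // oppr_ge0 pmulr_rle0 // ltW.
(* On the negative half-line an even [g] keeps the sign [s], an odd one reverses it. *)
case: gp => gp.
  exists s => // c c0 cx; rewrite -nE // gp // in_itv /= lerNl opprK.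
exists (- s); first by case: s1 => ->; rewrite ?opprK; [right|left].
by move=> c c0 cx; rewrite mulNr -nE // gp ?opprK // inE.
Qed.
End DerivativeWithin.

(** * Euclidean inner product, Bessel's inequality and small displacements *)

Section Inner.
Variables (R : realType) (d : nat).
Implicit Types u v w : 'rV[R]_d.

Lemma innerC u v : inner u v = inner v u.
Proof. by apply: eq_bigr => k _; rewrite mulrC. Qed.

Lemma innerDl u v w : inner (u + v) w = inner u w + inner v w.
Proof. by rewrite -big_split; apply: eq_bigr => k _; rewrite mxE mulrDl. Qed.

Lemma innerZl a u v : inner (a *: u) v = a * inner u v.
Proof. by rewrite big_distrr; apply: eq_bigr => k _; rewrite mxE /= mulrA. Qed.

Lemma innerNl u v : inner (- u) v = - inner u v.
Proof. by rewrite -scaleN1r innerZl mulN1r. Qed.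

Lemma innerDr u v w : inner u (v + w) = inner u v + inner u w.
Proof. by rewrite innerC innerDl !(innerC _ u). Qed.

Lemma innerZr a u v : inner u (a *: v) = a * inner u v.
Proof. by rewrite innerC innerZl innerC. Qed.

Lemma innerNr u v : inner u (- v) = - inner u v.
Proof. by rewrite innerC innerNl innerC. Qed.

Definition innerE := (innerDl, innerDr, innerNl, innerNr, innerZl, innerZr).

Lemma inner_suml (I : finType) (f : I -> 'rV[R]_d) v :
  inner (\sum_i f i) v = \sum_i inner (f i) v.
Proof.
apply: (big_morph (fun u => inner u v)); first by move=> x y; rewrite innerDl.
by rewrite -(scale0r 0) innerZl mul0r.
Qed.

Lemma inner_ge0 u : 0 <= inner u u.
Proof. by apply: sumr_ge0 => k _; rewrite -expr2 sqr_ge0. Qed.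

Lemma inner_eq0 u : inner u u = 0 -> u = 0.
Proof.
move=> /eqP; rewrite psumr_eq0 => [/allP H|k _]; last by rewrite -expr2 sqr_ge0.
apply/rowP => k; have /implyP/(_ isT) := H k (mem_index_enum k).
by rewrite mulf_eq0 orbb mxE => /eqP.
Qed.

Lemma esphereE u : esphere u <-> inner u u = 1.
Proof.
rewrite /esphere /enorm /=; split => [H|->]; last by rewrite sqrtr1.
by rewrite -(sqr_sqrtr (inner_ge0 u)) H expr1n.
Qed.

Lemma esphere_eball u : esphere u -> eball u.
Proof. by rewrite /esphere /eball /= => ->. Qed.

Lemma inner_continuous w : continuous (fun u => inner u w).
Proof.
apply: continuous_big => [|k _]; first exact: add_continuous.
by move=> u; apply: continuousM; [exact: coord_continuous|exact: cst_continuous].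
Qed.

(** For the projection [p] of [v] onto the frame, [inner p p] and [inner p v] both equal the sum of
    squares; expand the nonnegative squared norm of [v - p]. *)
Lemma bessel m (e : 'I_m -> 'rV[R]_d) v : orthonormal_family e ->
  \sum_i inner v (e i) ^+ 2 <= inner v v.
Proof.
move=> eO; set p := \sum_i inner v (e i) *: e i.
have pe w : inner p w = \sum_i inner v (e i) * inner (e i) w.
  by rewrite inner_suml; apply: eq_bigr => i _; rewrite innerZl.
have pv : inner p v = \sum_i inner v (e i) ^+ 2.
  by rewrite pe; apply: eq_bigr => i _; rewrite expr2 (innerC (e i)).
have pp : inner p p = inner p v.
  rewrite pe pv; apply: eq_bigr => i _; rewrite (innerC _ p) pe expr2; congr (_ * _).
  rewrite (bigD1 i) //= eO eqxx mulr1 big1 ?addr0 // => j ji.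
  by rewrite eO (negbTE ji) mulr0.
rewrite -pv -subr_ge0; have := inner_ge0 (v - p); rewrite !innerE pp (innerC v p); lra.
Qed.

(** Reduces a neighbourhood in the library's sup norm to bounds on two scalars. The [+ 1] in the
    denominator covers [p = q = 0]. *)
Lemma near_translations (P : set 'rV[R]_d) v p q : nbhs v P ->
  exists2 r : R, 0 < r & forall a b, `|a| < r -> `|b| < r -> P (v + a *: p + b *: q).
Proof.
move=> /nbhs_ballP [r /= r0 Hr].
have pq : 0 < `|p| + `|q| + 1 by rewrite ltr_wpDl // addr_ge0.
exists (r / (`|p| + `|q| + 1)) => [|a b]; first by rewrite divr_gt0.
rewrite !ltr_pdivlMr // => ar br; apply: Hr; rewrite -ball_normE /=.
rewrite -addrA opprD addrA subrr add0r normrN (le_lt_trans (ler_normD _ _)) // !normrZ.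
have := normr_ge0 a; have := normr_ge0 b; have := normr_ge0 p; have := normr_ge0 q.
by case: (leP `|a| `|b|) => ab; nra.
Qed.
End Inner.

(** * Elementary inequalities for profiles and square roots *)

Section Profile.
Variable R : realType.

Lemma sqr_le1 (x : R) : (x ^+ 2 <= 1) = (-1 <= x <= 1).
Proof. by rewrite -ler_norml -real_normK ?num_real // expr_le1. Qed.

Lemma profile_ge0 (H : R -> R) x : profile H -> 0 <= x <= 1 -> 0 <= H x.
Proof.
move=> HP /andP[]; rewrite le_eqVlt => /orP[/eqP <-|x0 x1]; first by rewrite (profile0 HP).
by rewrite -(profile0 HP) ltW // (profile_lt HP).
Qed.

Lemma profile_gt0 (H : R -> R) x : profile H -> 0 < x -> x <= 1 -> 0 < H x.
Proof. by move=> HP x0 x1; rewrite -(profile0 HP) (profile_lt HP). Qed.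

(** A convex graph lies below its chord from the origin to the point over 1. *)
Lemma profile_chord (H : R -> R) x : profile H -> 0 <= x <= 1 -> H x <= H 1 * x.
Proof.
move=> HP /andP[]; rewrite le_eqVlt => /orP[/eqP <-|x0]; first by rewrite (profile0 HP) mulr0.
rewrite le_eqVlt => /orP[/eqP ->|x1]; first by rewrite mulr1.
have := profile_convex HP (lexx 0) x0 x1 (lexx 1); rewrite (profile0 HP); nra.
Qed.

Lemma sqrt1D_dist (t : R) : `|t| < 1 -> `|Num.sqrt (1 + t) - 1| <= `|t|.
Proof.
rewrite ltr_norml => /andP[t1 t2].
have a0 := sqrtr_ge0 (1 + t); have a2 : Num.sqrt (1 + t) ^+ 2 = 1 + t by rewrite sqr_sqrtr //; lra.
set a := Num.sqrt _ in a0 a2 *.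
have -> : t = (a - 1) * (a + 1) by have -> : t = a ^+ 2 - 1 by [rewrite a2; ring|]; ring.
rewrite normrM -[leLHS]mulr1 ler_wpM2l // ger0_norm; lra.
Qed.
End Profile.

(** * Local maxima of the decomposed sum on the sphere *)

Section Frame.
Variables (R : realType) (d m : nat) (e : 'I_m -> 'rV[R]_d).
Variables (g H : 'I_m -> R -> R).
Hypothesis eO : orthonormal_family e.
Hypothesis HP : forall i, profile (H i).
Hypothesis gH : forall i x, -1 <= x <= 1 -> exists2 s, s = 1 \/ s = -1 &
  forall c, 0 < c -> -1 <= c * x <= 1 -> g i (c * x) = s * H i ((c * x) ^+ 2).

Local Notation G u := (\sum_i g i (inner u (e i))).

Lemma frame_sqr_sum u : esphere u -> \sum_i inner u (e i) ^+ 2 <= 1.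
Proof. by move=> /esphereE <-; exact: bessel. Qed.

Lemma frame_sqr_le1 i u : esphere u -> inner u (e i) ^+ 2 <= 1.
Proof.
move=> /frame_sqr_sum; apply: le_trans; rewrite (bigD1 i) //= lerDl.
by apply: sumr_ge0 => j _; exact: sqr_ge0.
Qed.

Lemma frame_coord_le1 i u : esphere u -> -1 <= inner u (e i) <= 1.
Proof. by move=> /frame_sqr_le1 => /(_ i); rewrite sqr_le1. Qed.

Lemma normr_contribution i x : -1 <= x <= 1 -> `|g i x| = H i (x ^+ 2).
Proof.
move=> x1; have [s s1 gs] := gH i x1.
have := gs 1 ltr01; rewrite mul1r => -> //; rewrite normrM.
have -> : `|s| = 1 by case: s1 => ->; rewrite ?normrN normr1.
by rewrite mul1r ger0_norm // profile_ge0 // sqr_ge0 /= sqr_le1.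
Qed.

Lemma contribution0 i : g i 0 = 0.
Proof.
by apply/eqP; rewrite -normr_eq0 normr_contribution ?lerN10 ?ler01 // expr0n (profile0 (HP i)).
Qed.

Lemma frame_local_max k v : v = e k \/ v = - e k ->
  \forall u \near v, esphere u -> `|G u| <= `|G v|.
Proof.
move=> vk.
have vE i : inner v (e i) ^+ 2 = (i == k)%:R.
  by case: vk => ->; rewrite ?innerNl eO ?sqrrN eq_sym; case: eqP => _; rewrite ?expr1n ?expr0n.
have v1 : -1 <= inner v (e k) <= 1 by rewrite -sqr_le1 vE eqxx.
have Gv : `|G v| = H k 1.
  rewrite (bigD1 k) //= big1 ?addr0 => [|i ik]; first by rewrite normr_contribution // vE eqxx.
  have /eqP := vE i; rewrite (negbTE ik) sqrf_eq0 => /eqP ->; exact: contribution0.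
have Hk1 : 0 < H k 1 by rewrite profile_gt0.
(* Flatness of [H i] is used with the constant [H k 1], the value of the sum at [v] up to sign. *)
have /choice[r rP] i : exists r, 0 < r /\ forall x, 0 <= x <= 1 -> x < r -> H i x <= H k 1 * x.
  by have [r r0 rP] := profile_flat (HP i) Hk1; exists r.
(* By Bessel this forces every other squared coordinate [i] of [u] below [r i], where the flatness
   bound applies. *)
have close : \forall u \near v, forall i, 1 - r i < inner u (e k) ^+ 2.
  apply: (@filter_forall _ _ (fun i u => 1 - r i < inner u (e k) ^+ 2) (nbhs v)) => i.
  have vc : {for v, continuous (fun u => inner u (e k) * inner u (e k))}.
    by apply: continuousM; exact: inner_continuous.
  under eq_near do rewrite expr2.
  apply: (cvgr_gt _ vc) => /=; rewrite -expr2 vE eqxx.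
  by have [r0 _] := rP i; rewrite ltrBlDr ltrDl.
near=> u => su; rewrite Gv.
have ub : forall i, 1 - r i < inner u (e k) ^+ 2 by near: u.
apply: (le_trans (ler_norm_sum _ _ _)).
apply: (@le_trans _ _ (\sum_i H k 1 * inner u (e i) ^+ 2)); last first.
  by rewrite -big_distrr /= ger_pMr // frame_sqr_sum.
apply: ler_sum => i _; rewrite normr_contribution ?frame_coord_le1 //.
have ui : 0 <= inner u (e i) ^+ 2 <= 1 by rewrite sqr_ge0 frame_sqr_le1.
have [->|ik] := eqVneq i k; first by rewrite profile_chord // sqr_ge0 frame_sqr_le1.
apply: (rP i).2 => //; have := ub i; have := frame_sqr_sum su.
rewrite (bigD1 k) //= (bigD1 i) //=.
have : 0 <= \sum_(j < m | (j != k) && (j != i)) inner u (e j) ^+ 2.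
  by apply: sumr_ge0 => j _; exact: sqr_ge0.
lra.
Unshelve. all: by end_near. Qed.
(** The conditions on [y] say that it is an orthogonal component of [v] perpendicular to [e k].
    Rescaling the [e k] component by [a] and [y] by [b] transfers squared norm [t], of either sign,
    from [y] to the [e k] component without leaving the sphere; maximality at [v] is then read off
    with the [k]-th term isolated. *)
Lemma rotation_bound (eps : R) v k y :
  esphere v -> (\forall u \near v, esphere u -> eps * G u <= eps * G v) ->
  (forall c, 0 < c -> -1 <= c * inner v (e k) <= 1 ->
    eps * g k (c * inner v (e k)) = H k ((c * inner v (e k)) ^+ 2)) ->
  inner v (e k) != 0 -> inner v y = inner y y -> 0 < inner y y ->
  inner (e k) y = 0 ->
  exists2 r, 0 < r & forall t, `|t| < r ->
    [/\ `|t| < inner v (e k) ^+ 2, `|t| < inner y y &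
     exists b, [/\ 0 < b, b ^+ 2 * inner y y = inner y y - t &
       H k (inner v (e k) ^+ 2 + t) +
         \sum_(i | i != k) eps * g i (inner v (e i) + (b - 1) * inner y (e i)) <=
       H k (inner v (e k) ^+ 2) + \sum_(i | i != k) eps * g i (inner v (e i))]].
Proof.
move=> sv vmax gk vk0 vy y0 ky.
set vk := inner v (e k) in gk vk0 *; set B := inner y y in vy y0 *.
have A0 : 0 < vk ^+ 2 by rewrite exprn_even_gt0.
set A := vk ^+ 2 in A0 *.
have [r r0 rP] := near_translations (vk *: e k) y vmax.
(* The bounds [A] and [B] keep both rescaled squared norms positive; [r * A] and [r * B] keep
   [a - 1] and [b - 1] below [r] in absolute value. *)
exists (Num.min (Num.min A B) (Num.min (r * A) (r * B))).
  by rewrite !lt_min A0 y0 /= (mulr_gt0 r0 A0) (mulr_gt0 r0 y0).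
move=> t; rewrite !lt_min => /andP[/andP[tA tB] /andP[trA trB]].
split=> //.
(* Stated for [t'] to serve both rescalings: [A] gains [t] while [B] gains [- t]. *)
have sq C : 0 < C -> `|t| < C -> `|t| < r * C -> forall t' : R, `|t'| = `|t| ->
  [/\ 0 < Num.sqrt (1 + t' / C), Num.sqrt (1 + t' / C) ^+ 2 * C = C + t' &
     `|Num.sqrt (1 + t' / C) - 1| < r].
  move=> C0 tC trC t' tt.
  have tC1 : `|t' / C| < 1.
    by rewrite normrM tt normfV (gtr0_norm C0) ltr_pdivrMr // mul1r.
  have pos : 0 < 1 + t' / C by move: tC1; rewrite ltr_norml; lra.
  split; first by rewrite sqrtr_gt0.
    by rewrite sqr_sqrtr ?ltW // mulrDl mul1r divfK // gt_eqF.
  apply: le_lt_trans (sqrt1D_dist tC1) _.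
  by rewrite normrM tt normfV (gtr0_norm C0) ltr_pdivrMr.
have [a0 a2 ar] := sq A A0 tA trA t erefl.
have [b0 b2 br] := sq B y0 tB trB (- t) (normrN t).
set a := Num.sqrt _ in a0 a2 ar; set b := Num.sqrt _ in b0 b2 br.
exists b; split => //.
set u := v + (a - 1) *: (vk *: e k) + (b - 1) *: y.
have uk : inner u (e k) = a * vk.
  by rewrite /u !innerE -/vk eO eqxx (innerC y) ky /=; ring.
have ui i : i != k -> inner u (e i) = inner v (e i) + (b - 1) * inner y (e i).
  by move=> ik; rewrite /u !innerE eO eq_sym (negbTE ik) /=; ring.
have su : esphere u.
  apply/esphereE; rewrite /u !innerE eO eqxx (innerC (e k) v) (innerC y v) (innerC y (e k)) ky vy.
  rewrite (esphereE v).1 // -/vk -/B /=.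
  transitivity (1 - A - B + a ^+ 2 * A + b ^+ 2 * B); first by rewrite /A; ring.
  by rewrite a2 b2; ring.
have := rP _ _ ar br su; rewrite !mulr_sumr (bigD1 k) //= [leRHS](bigD1 k) //= uk.
rewrite gk //; last by rewrite -uk frame_coord_le1.
have -> : (a * vk) ^+ 2 = A + t by rewrite exprMn.
rewrite -[in eps * g k vk](mul1r vk) gk ?mul1r ?frame_coord_le1 // -/A.
by under eq_bigr => i ik do rewrite ui //.
Qed.

Lemma local_max_frame v : (0 < m)%N -> esphere v ->
  (\forall u \near v, esphere u -> `|G u| <= `|G v|) ->
  exists k, v = e k \/ v = - e k.
Proof.
move=> m0 sv vmax.
have [eps eps1 oG] : exists2 eps, eps = 1 \/ eps = -1 & `|G v| = eps * G v.
  case: (leP 0 (G v)) => Gv; first by exists 1; rewrite ?mul1r ?ger0_norm //; left.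
  by exists (-1); rewrite ?mulN1r ?ltr0_norm //; right.
have epsn : `|eps| = 1 by case: eps1 => ->; rewrite ?normrN normr1.
have omax : \forall u \near v, esphere u -> eps * G u <= eps * G v.
  near=> u => su; rewrite -oG (le_trans (ler_norm _)) // normrM epsn mul1r.
  by move: su; near: u.
have /choice[s sP] i : exists s : R, (s = 1 \/ s = -1) /\
    forall c, 0 < c -> -1 <= c * inner v (e i) <= 1 ->
      eps * g i (c * inner v (e i)) = s * H i ((c * inner v (e i)) ^+ 2).
  have [s s1 sg] := gH i (frame_coord_le1 i sv); exists (eps * s); split.
    by case: eps1 => ->; case: s1 => ->; rewrite ?mulrNN ?mulr1 ?mul1r; [left|right|right|left].
  by move=> c c0 cv; rewrite sg // mulrA.
have ogv i : eps * g i (inner v (e i)) = s i * H i (inner v (e i) ^+ 2).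
  by have := (sP i).2 1 ltr01; rewrite mul1r; apply; exact: frame_coord_le1.
(* Otherwise every term is nonpositive while their sum is [|G v|], so all terms vanish and [v] is
   orthogonal to the frame. *)
have [k vk0 sk] : exists2 k, inner v (e k) != 0 & s k = 1.
  apply: contrapT => nk.
  have sN i : inner v (e i) != 0 -> s i = -1.
    by move=> vi; case: (sP i).1 => // si; case: nk; exists i.
  have le0 i : s i * H i (inner v (e i) ^+ 2) <= 0.
    have [->|vi] := eqVneq (inner v (e i)) 0; first by rewrite expr0n (profile0 (HP i)) mulr0.
    by rewrite sN // mulN1r oppr_le0 profile_ge0 // sqr_ge0 frame_sqr_le1.
  have sum0 : \sum_i (- (s i * H i (inner v (e i) ^+ 2))) = 0.
    apply/eqP; rewrite eq_le sumr_ge0 ?andbT => [|i _]; last by rewrite oppr_ge0.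
    rewrite sumrN oppr_le0 -(eq_bigr _ (fun i _ => ogv i)) -mulr_sumr -oG.
    exact: normr_ge0.
  have v0 i : inner v (e i) = 0.
    apply/eqP; apply: contrapT => /negP vi.
    move/eqP: sum0; rewrite psumr_eq0 => [/allP/(_ i (mem_index_enum i))|j _]; last by rewrite oppr_ge0.
    rewrite sN // mulN1r opprK gt_eqF // profile_gt0 ?frame_sqr_le1 //.
    by rewrite exprn_even_gt0.
  have Gv0 : G v = 0.
    by rewrite big1 // => i _; rewrite v0 contribution0.
  pose i := Ordinal m0.
  have [r r0 rP] := near_translations (e i) v vmax.
  (* The competitor is [a *: e i + b *: v] with squared coefficients summing to 1. As [a < 1], the
     deviation of [b] from 1 is at most [a ^+ 2 < a < r]. *)
  set a := Num.min r 1 / 2.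
  have [a0 ar a1] : [/\ 0 < a, a < r & a < 1].
    have : 0 < Num.min r 1 by rewrite lt_min r0 ltr01.
    have : Num.min r 1 <= r by rewrite ge_min lexx.
    have : Num.min r 1 <= 1 by rewrite ge_min lexx orbT.
    by rewrite /a; split; lra.
  have a2 : 0 < a ^+ 2 < a by rewrite exprn_gt0 //= expr2 gtr_pMr.
  have na : `|- (a ^+ 2)| = a ^+ 2 by rewrite normrN ger0_norm // ltW //; case/andP: a2.
  have bP := @sqrt1D_dist R (- (a ^+ 2)).
  have br : `|Num.sqrt (1 - a ^+ 2) - 1| < r.
    by apply: le_lt_trans (bP _) _; rewrite na; lra.
  have b2 : Num.sqrt (1 - a ^+ 2) ^+ 2 = 1 - a ^+ 2 by rewrite sqr_sqrtr //; lra.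
  set b := Num.sqrt _ in br b2.
  set u := v + a *: e i + (b - 1) *: v.
  have uE j : inner u (e j) = a * (i == j)%:R by rewrite /u !innerE v0 eO; ring.
  have su : esphere u.
    apply/esphereE; rewrite /u !innerE eO eqxx (innerC (e i)) v0 (esphereE v).1 //.
    transitivity (a ^+ 2 + b ^+ 2); first by rewrite /=; ring.
    by rewrite b2; ring.
  have := rP a (b - 1); rewrite (gtr0_norm a0) => /(_ ar br su).
  rewrite Gv0 normr0 leNgt => /negP; apply.
  rewrite (bigD1 i) //= big1 ?addr0 => [|j ji]; last first.
    by rewrite uE eq_sym (negbTE ji) mulr0 contribution0.
  rewrite uE eqxx mulr1 normr_contribution; last by lra.
  by apply: profile_gt0 => //; lra.
exists k; set A := inner v (e k) ^+ 2.
have A0 : 0 < A by rewrite exprn_even_gt0.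
have gk c : 0 < c -> -1 <= c * inner v (e k) <= 1 ->
    eps * g k (c * inner v (e k)) = H k ((c * inner v (e k)) ^+ 2).
  by move=> c0 cv; rewrite (sP k).2 // sk mul1r.
(* Rotate between [e k] and [e i]: the remaining coordinates are fixed, so only two terms of the sum
   change. *)
have vi0 i : i != k -> inner v (e i) = 0.
  move=> ik; apply/eqP; apply: contrapT => /negP vi.
  set B := inner v (e i) ^+ 2.
  have B0 : 0 < B by rewrite exprn_even_gt0.
  have AB : A + B <= 1.
    apply: le_trans (frame_sqr_sum sv).
    rewrite (bigD1 k) //= (bigD1 i) //= addrA lerDl.
    by apply: sumr_ge0 => j _; exact: sqr_ge0.
  pose y := inner v (e i) *: e i.
  have yy : inner y y = B by rewrite /y !innerE eO eqxx /B /=; ring.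
  have [|||r r0 rP] := @rotation_bound eps v k y sv omax gk vk0.
  - by rewrite yy /y innerE /B expr2.
  - by rewrite yy.
  - by rewrite /y innerE eO eq_sym (negbTE ik) mulr0.
  have step t : `|t| < r -> [/\ `|t| < A, `|t| < B &
      H k (A + t) + s i * H i (B - t) <= H k A + s i * H i B].
    move=> /rP[]; rewrite yy -/A => tA tB [b [b0 b2 main]]; split => //; move: main.
    rewrite (bigD1 i) // [in leRHS](bigD1 i) //=.
    have -> : inner v (e i) + (b - 1) * inner y (e i) = b * inner v (e i).
      by rewrite /y innerE eO eqxx /=; ring.
    have bv : (b * inner v (e i)) ^+ 2 = B - t by rewrite exprMn.
    move: tA tB; rewrite !ltr_norml => tA tB.
    rewrite (sP i).2 //; last by rewrite -sqr_le1 bv; lra.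
    rewrite bv ogv -/B !addrA.
    rewrite (eq_bigr (fun j => eps * g j (inner v (e j)))) => [|j /andP[jk ji]]; last first.
      by rewrite /y innerE eO eq_sym (negbTE ji) !mulr0 addr0.
    by rewrite lerD2r.
  set t := r / 2.
  have [t0 tr] : 0 < t /\ t < r by rewrite /t; lra.
  have := step t; rewrite (gtr0_norm t0) => /(_ tr)[tA tB pos].
  have := step (- t); rewrite normrN (gtr0_norm t0) => /(_ tr)[_ _].
  rewrite opprK => neg.
  (* If [s i = -1], moving [t > 0] strictly increases both terms. If [s i = 1], strict convexity
     makes the sum of the bounds for [t] and [- t] contradictory; [A + B <= 1] keeps all arguments
     in [0, 1]. *)
  have [si|si] := (sP i).1; last first.
    have : H k A < H k (A + t) by apply: (profile_lt (HP k)); lra.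
    have : H i (B - t) < H i B by apply: (profile_lt (HP i)); lra.
    by move: pos; rewrite si; lra.
  have ck : (H k A - H k (A - t)) * (A + t - A) < (H k (A + t) - H k A) * (A - (A - t)).
    by apply: (profile_convex (HP k)); lra.
  have ci : (H i B - H i (B - t)) * (B + t - B) < (H i (B + t) - H i B) * (B - (B - t)).
    by apply: (profile_convex (HP i)); lra.
  have ck' : H k A - H k (A - t) < H k (A + t) - H k A by nra.
  have ci' : H i B - H i (B - t) < H i (B + t) - H i B by nra.
  by move: pos neg; rewrite si; lra.
(* What remains of [v] is orthogonal to the whole frame; if it were nonzero, moving squared norm
   from it into [e k] would raise the [k]-th term alone. *)
pose y := v - inner v (e k) *: e k.
have ye i : inner y (e i) = 0.
  rewrite /y !innerE eO; have [->|ik] := eqVneq k i; first by rewrite mulr1 subrr.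
  by rewrite vi0 1?eq_sym // mulr0 subr0.
have yy : inner v y = inner y y by rewrite {3}/y innerDr innerNr innerZr -/y ye mulr0 subr0 innerC.
have yA : inner y y = 1 - A.
  by rewrite -yy /y !innerE (esphereE v).1 // /A expr2.
have y0 : inner y y = 0.
  apply/eqP; rewrite eq_le inner_ge0 andbT leNgt; apply/negP => y0.
  have [|r r0 rP] := @rotation_bound eps v k y sv omax gk vk0 yy y0; first by rewrite innerC.
  set t := r / 2.
  have [t0 tr] : 0 < t /\ t < r by rewrite /t; lra.
  have := rP t; rewrite (gtr0_norm t0) => /(_ tr)[]; rewrite -/A => tA tB [b [b0 b2 +]].
  rewrite (eq_bigr (fun j => eps * g j (inner v (e j)))) => [|j _]; last by rewrite ye mulr0 addr0.
  rewrite lerD2r leNgt => /negP; apply; apply: (profile_lt (HP k)); lra.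
have vE : v = inner v (e k) *: e k by apply/eqP; rewrite -subr_eq0; apply/eqP/inner_eq0.
have /eqP : A = 1 by lra.
by rewrite sqrf_eq1 => /orP[] /eqP vk1; [left|right]; rewrite vE vk1 ?scale1r ?scaleN1r.
Unshelve. all: by end_near. Qed.
End Frame.

Theorem theorem2p6 (R : realType) (d m : nat) (hd : (2 <= d)%N)
    (hm : (1 <= m <= d)%N) (e : 'I_m -> 'rV[R]_d) (g : 'I_m -> R -> R)
    (F : 'rV[R]_d -> R) (hF : odeco_decomposition e g F)
    (v : 'rV[R]_d) (hv : esphere v) :
  local_max_on (@esphere R d) (fun u => `|F u|) v <->
  exists i : 'I_m, v = e i \/ v = - e i.
Proof.
have [eO gc FE] := hF; have /andP[m0 _] := hm.
have /choice[H HgH] i : exists H, profile H /\ forall x, -1 <= x <= 1 ->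
    exists2 s, s = 1 \/ s = -1 &
    forall c, 0 < c -> -1 <= c * x <= 1 -> g i (c * x) = s * H ((c * x) ^+ 2).
  by have [H HP gH] := contribution_profile (gc i); exists H.
have HP i : profile (H i) := (HgH i).1.
have gH i := (HgH i).2.
have FS u : esphere u -> F u = \sum_i g i (inner u (e i)).
  by move=> /esphere_eball; exact: FE.
split=> [[_ vmax]|[k vk]].
  apply: (local_max_frame eO HP gH) => //; move: vmax; rewrite near_withinE.
  by apply: filterS => u + su => /(_ su); rewrite !FS.
split=> //; rewrite near_withinE; have := frame_local_max eO HP gH vk.
by apply: filterS => u + su => /(_ su); rewrite !FS.
Qed.
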